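(* For each $1\leq p < \infty$, $B^{p}$ contains an isometric and complemented copy of $\ell^{p}(\mathfrak c,L^{p}[0,1])$.
   Context: Let $\mathcal{B}$ be the Borel $\sigma$-algebra of $\mathbb{R}$, $\lambda$ the Lebesgue measure, and $\mathcal{B}_{\infty}$ the $\sigma$-algebra on $\mathbb{R}^{\mathbb{N}}$ generated by the cylinder sets $\prod_{i=1}^{m}C_{i}\times\prod_{i=m+1}^{\infty}\mathbb{R}$ with $C_i\in\mathcal{B}$, $m\in\mathbb{N}$. Let $\mathcal{F}(\mathcal{B},\lambda)$ be the set of finite rectangles $\prod_{i\in\mathbb{N}}C_{i}$ with $C_i\in\mathcal{B}$ and $\prod_{i}\lambda(C_i)\in[0,\infty)$, with $\mathrm{vol}(\prod_{i}C_i):=\prod_i\lambda(C_i)$. The measure $\mu$ is the restriction to $\mathcal{B}_{\infty}$ of the outer measure $\mu^{\ast}(A):=\inf\{\sum_{n}\mathrm{vol}(\mathscr{C}_{n}) : \mathscr{C}_{n}\in\mathcal{F}(\mathcal{B},\lambda),\ A\subset\bigcup_{n}\mathscr{C}_{n}\}$ ($\inf\varnothing=\infty$). Let $I:=\mathbb{Z}^{\mathbb{N}}$ and, for $\mathfrak{a}=(a_n)\in I$, $\mathcal{C}_{\mathfrak{a}}:=\prod_{n\in\mathbb{N}}[a_{n},a_{n}+1)$. Define $B^{p}:=\{f\in L^{p}(\mu) : \int_{\mathcal{C}_{\mathfrak{a}}}|f|^{p}\,d\mu=0 \text{ for each } \mathfrak{a}\in I\}$, a closed subspace of $L^p(\mu)$.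 $\ell^{p}(\kappa,X)$ denotes the $\ell^p$-sum of $\kappa$ copies of the Banach space $X$, and $\mathfrak{c}$ is the cardinality of the continuum. *)

(* Defs.v *)
From HB Require Import structures.
From mathcomp Require Import all_boot all_order all_algebra.
From mathcomp Require Import all_classical all_reals all_analysis.
Set Implicit Arguments. Unset Strict Implicit. Unset Printing Implicit Defensive.
Import Order.TTheory GRing.Theory Num.Theory.
Import numFieldNormedType.Exports.
Local Open Scope classical_set_scope.
Local Open Scope ring_scope.

Section InfiniteProduct.
Variable R : realType.

Definition cylinder (A : set (nat -> R)) : Prop :=
  exists (m : nat) (C : nat -> set (measurableTypeR R)),
    (forall i, measurable (C i)) /\
    A = [set x | forall i, (i < m)%N -> C i (x i)].

Definition RN := g_sigma_algebraType cylinder.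

Definition rect (C : nat -> set (measurableTypeR R)) : set (nat -> R) :=
  [set x | forall i, C i (x i)].

Local Open Scope ereal_scope.

Definition partial_vol (C : nat -> set (measurableTypeR R)) (n : nat) : \bar R :=
  \prod_(i < n) lebesgue_measure (C i).

Definition finite_rect (C : nat -> set (measurableTypeR R)) : Prop :=
  (forall i, measurable (C i)) /\
  exists r : R, partial_vol C @ \oo --> r%:E.

Definition vol (C : nat -> set (measurableTypeR R)) : \bar R :=
  lim (partial_vol C @ \oo).

(* outer measure mu^* ; inf of the empty set is +oo *)
Definition mu_star (A : set (nat -> R)) : \bar R :=
  ereal_inf [set \sum_(0 <= n <oo) vol (C n) |
    C in [set C : nat -> nat -> set (measurableTypeR R) |
            (forall n, finite_rect (C n)) /\ A `<=` \bigcup_n rect (C n)]].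

Local Close Scope ereal_scope.

Definition cube (a : nat -> int) : set RN :=
  [set x | forall n, (a n)%:~R <= x n < (a n)%:~R + 1].

(* membership in B^p (as functions; L^p-elements are taken up to m-a.e. equality) *)
Definition Bp (m : {measure set RN -> \bar R}) (p : R) (f : RN -> R) : Prop :=
  f \in Lfun m p%:E /\
  forall a : nat -> int, (\int[m]_(x in cube a) (`|f x| `^ p)%:E)%E = 0%E.

Definition lambda01 : {measure set (measurableTypeR R) -> \bar R} :=
  mrestr (@lebesgue_measure R) (measurable_itv `[0%R, 1%R]).

(* l^p(c, L^p[0,1]) : families indexed by R (|R| = c) *)
Definition ellp_norm (p : R) (g : R -> measurableTypeR R -> R) : \bar R :=
  ((\esum_(i in [set: R]) ('N[lambda01]_(p%:E)[EFin \o g i] `^ p)) `^ p^-1)%E.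

Definition ellp (p : R) (g : R -> measurableTypeR R -> R) : Prop :=
  (forall i, g i \in Lfun lambda01 p%:E) /\ (ellp_norm p g < +oo)%E.

End InfiniteProduct.

(* Main.v *)
Require Import Defs.
From HB Require Import structures.
From mathcomp Require Import all_boot all_order all_algebra.
From mathcomp Require Import finmap.
From mathcomp Require Import all_classical all_reals all_analysis.
From mathcomp Require Import measurable_realfun lra.
Set Implicit Arguments. Unset Strict Implicit. Unset Printing Implicit Defensive.
Import Order.TTheory GRing.Theory Num.Theory.
Import numFieldNormedType.Exports.
Local Open Scope classical_set_scope.
Local Open Scope ring_scope.

(** For each real [i] let [E_i] be the product of [[0, 1]] and of the intervals
    [[k_n + 1/2, k_n + 3/2[] with [k_n = floor (i * n)], [n >= 1].  The [E_i]
    are disjoint, each has measure 1, and each meets every cube in a null set,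
    since an integer interval covers at most half of a side.  The embedding
    sends [(g_i)] to the function equal to [g_i (y_0)] on [E_i]; the projection
    averages a function on each [E_i] over all coordinates but the first, which
    is a contraction by Jensen's inequality.

    That [mu^* (E_i) >= 1] is proved by truncating a cover of total volume less
    than 1 to cylinders and choosing the coordinates of an uncovered point one
    at a time.  That [mu] on [E_i] is the product of [lambda] on [[0, 1]] and of
    the averaging measure then needs no uniqueness theorem: the product is below
    [mu] on finite rectangles, hence below [mu^*], and has the same total
    mass. *)

(** * Integrals of p-th powers and Jensen's inequality *)

Section Lp_integral.
Context d (T : measurableType d) (R : realType).
Variable mu : {measure set T -> \bar R}.
Local Open Scope ereal_scope.
Implicit Types (f : T -> R) (p : R).

Lemma measurable_norm_powR (D : set T) f p : measurable_fun D f ->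
  measurable_fun D (fun x => (`|f x| `^ p)%:E).
Proof.
move=> mf; apply/measurable_EFinP.
apply: (@measurableT_comp _ _ _ _ _ _ (@powR R ^~ p)) => //.
exact: measurableT_comp.
Qed.

Lemma Lnorm_powE f p : (1 <= p)%R ->
  'N[mu]_(p%:E)[EFin \o f] `^ p = \int[mu]_x (`|f x| `^ p)%:E.
Proof. by move=> p1; rewrite poweR_Lnorm// gt_eqF// (lt_le_trans ltr01). Qed.

Lemma LnormE_integral f p :
  'N[mu]_(p%:E)[EFin \o f] = (\int[mu]_x (`|f x| `^ p)%:E) `^ p^-1.
Proof. by rewrite unlock. Qed.

Lemma Lfun_integralP f p : (1 <= p)%R ->
  f \in Lfun mu p%:E <->
  measurable_fun setT f /\ \int[mu]_x (`|f x| `^ p)%:E < +oo.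
Proof.
move=> p1; split.
  rewrite inE => /andP[/[!inE]/= mf]; rewrite /finite_norm => /(poweR_lty p).
  by rewrite Lnorm_powE.
move=> [mf fin]; rewrite inE; apply/andP; split; rewrite inE//=.
by rewrite /finite_norm LnormE_integral poweR_lty.
Qed.

Lemma ge0_integral_mrestr (D : set T) (mD : measurable D) (f : T -> \bar R) :
  measurable_fun setT f -> (forall x, 0 <= f x) ->
  \int[mrestr mu mD]_x f x = \int[mu]_(x in D) f x.
Proof.
move=> mf f0.
rewrite (@ge0_negligible_integral _ _ _ (mrestr mu mD) setT (~` D))//; first last.
- by rewrite /= /mrestr setICl measure0.
- exact: measurableC.
rewrite setTD setCK; apply: eq_measure_integral => A mA AD.
by rewrite /= /mrestr setIidl.
Qed.

(* Jensen's inequality for [t |-> t ^ p]; the integral on the left may be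
   infinite or undefined, in which case [fine] makes it [0] *)
Lemma powR_integral_le f p : (1 <= p)%R -> mu setT = 1 ->
  measurable_fun setT f ->
  (`|fine (\int[mu]_x (f x)%:E)| `^ p)%:E <= \int[mu]_x (`|f x| `^ p)%:E.
Proof.
move=> p1 mu1 mf.
have p0 : (0 < p)%R by rewrite (lt_le_trans ltr01).
(* Hölder's inequality against the constant 1, of norm 1 since [mu] has mass 1. For p = 1 the
   conjugate exponent would be infinite, hence the separate case. *)
have If : \int[mu]_x `|(f x)%:E| <= 'N[mu]_p%:E[EFin \o f].
  have [->|pn1] := eqVneq p 1%R; first by rewrite Lnorm1.
  have p1' : (1 < p)%R by rewrite lt_neqAle eq_sym pn1.
  have q0 : (0 < (1 - p^-1)^-1)%R.
    by rewrite invr_gt0 subr_gt0 invf_lt1.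
  have := @hoelder _ _ _ mu f (cst 1%R) p (1 - p^-1)^-1 mf _ p0 q0.
  rewrite invrK subrKC => /(_ (measurable_cst _) erefl).
  rewrite Lnorm_cst1 mu1 poweR1r mule1 Lnorm1.
  by under eq_integral do rewrite /= mulr1.
rewrite -Lnorm_powE// -poweR_EFin; apply: gt0_ler_poweR => //.
- exact: ltW.
- by rewrite in_itv/= leey lee_fin normr_ge0.
- by rewrite in_itv/= leey Lnorm_ge0.
apply: le_trans If.
have /measurable_EFinP mEf := mf.
apply: le_trans (le_abse_integral mu measurableT mEf).
by case: (integral _ _ _) => [r| |]//=; rewrite ?normr0 ?leey ?lexx.
Qed.

End Lp_integral.

(** * Averaging over the second factor of a product *)

Section section_average.
Context d1 d2 (T1 : measurableType d1) (T2 : measurableType d2) (R : realType).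
Variable m1 : {finite_measure set T1 -> \bar R}.
Variable m2 : {finite_measure set T2 -> \bar R}.
Hypothesis m2T : m2 setT = 1%E.
Variable p : R.
Hypothesis p1 : 1 <= p.
Local Open Scope ereal_scope.
Implicit Types f g : T1 * T2 -> R.

(** As [m2] is a probability, this is the conditional expectation given the first coordinate. For
    [f] in L^p, [fine] replaces an infinite or undefined integral by 0 only on an [m1]-null set of
    [x]. *)
Definition section_average f (x : T1) : R := fine (\int[m2]_y (f (x, y))%:E).

Lemma product_measure_fin_numT : (m1 \x m2) setT \is a fin_num.
Proof.
rewrite -setXTT product_measure1E// fin_numM//.
- exact: fin_num_measure.
- exact: fin_num_measure.
Qed.

Lemma Lfun_product_integrable f :
  measurable_fun setT f -> \int[m1 \x m2]_z (`|f z| `^ p)%:E < +oo ->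
  (m1 \x m2).-integrable setT (EFin \o f).
Proof.
move=> mf fin; apply/Lfun1_integrable.
apply: (@Lfun_subset _ _ _ _ 1 p%:E) => //.
- exact: product_measure_fin_numT.
- exact/Lfun_integralP.
Qed.

Lemma measurable_section_average f :
  measurable_fun setT f -> \int[m1 \x m2]_z (`|f z| `^ p)%:E < +oo ->
  measurable_fun setT (section_average f).
Proof.
move=> mf fin; apply: (@measurableT_comp _ _ _ _ _ _ (@fine R)).
  exact: fine_measurable.
exact: (measurable_fubini_F (Lfun_product_integrable mf fin)).
Qed.

Lemma section_average_le f : measurable_fun setT f ->
  \int[m1 \x m2]_z (`|f z| `^ p)%:E < +oo ->
  \int[m1]_x (`|section_average f x| `^ p)%:E <=
  \int[m1 \x m2]_z (`|f z| `^ p)%:E.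
Proof.
move=> mf fin.
have mfp := measurable_norm_powR p mf.
have fp0 z : 0 <= (`|f z| `^ p)%:E by rewrite lee_fin powR_ge0.
rewrite (fubini_tonelli1 (fun z => (`|f z| `^ p)%:E))//.
apply: ge0_le_integral => //.
- exact/measurable_norm_powR/measurable_section_average.
- exact: (measurable_fun_fubini_tonelli_F (fun z => (`|f z| `^ p)%:E)).
- move=> x _; apply: powR_integral_le => //.
  exact: (measurableT_comp mf).
Qed.

(** Holds almost everywhere: splitting the integral needs both sections at [x] to be integrable,
    which Fubini gives for almost every [x]. *)
Lemma section_averageD f g (a : R) :
  measurable_fun setT f -> \int[m1 \x m2]_z (`|f z| `^ p)%:E < +oo ->
  measurable_fun setT g -> \int[m1 \x m2]_z (`|g z| `^ p)%:E < +oo ->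
  section_average (fun z => a * f z + g z)%R =
  (fun x => a * section_average f x + section_average g x)%R %[ae m1].
Proof.
move=> mf finf mg fing.
have := ae_integrable1 (Lfun_product_integrable mf finf).
have := ae_integrable1 (Lfun_product_integrable mg fing).
apply: filterS2 => x ig if_ _.
rewrite /section_average.
under eq_integral do rewrite EFinD EFinM.
rewrite integralD//; last exact: integrableZl.
rewrite integralZl// fineD ?fineM//.
- exact: integrable_fin_num.
- by rewrite fin_numM//; exact: integrable_fin_num.
- exact: integrable_fin_num.
Qed.

End section_average.

(** * Countable unions and sums over large index sets *)

(** Replaces a countable index set by a sequence, so that countable additivity applies; the blocks
    are the fibres of an injection into the naturals. *)
Lemma countable_partition1 (I : choiceType) (S : set I) : countable S ->
  exists u : nat -> set I, [/\ S = \bigcup_n u n, trivIset setT u &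
    forall n, u n = set0 \/ exists i, u n = [set i]].
Proof.
move=> /countable_injP[c cinj]; exists (fun n => S `&` c @^-1` [set n]); split.
- apply/seteqP; split => [i Si|i [n _ []]//]; first by exists (c i).
- by move=> n k _ _ [i [[_ /= <-] [_ /= <-]]].
- move=> n; have [->|/set0P[i [Si /= cin]]] := eqVneq (S `&` c @^-1` [set n]) set0.
    by left.
  right; exists i; apply/seteqP; split => [j [Sj /= cjn]|j /= ->//].
  by apply: cinj; rewrite ?inE// cin cjn.
Qed.

Lemma countable_setU (I : Type) (A B : set I) :
  countable A -> countable B -> countable (A `|` B).
Proof.
move=> cA cB.
rewrite (_ : A `|` B = \bigcup_(b in [set: bool]) (if b then A else B)).
  by apply: bigcup_countable => [|[]]//; exact: countableP.
apply/seteqP; split => [i []|i [[] _]]; [by exists true|by exists false|by left|by right].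
Qed.

(** For each n only finitely many terms are at least 1/(n+1), and the support is the union over n of
    these index sets. *)
Lemma countable_esum_support (R : realType) (I : choiceType) (a : I -> \bar R) :
  (forall i, 0 <= a i)%E -> (\esum_(i in setT) a i < +oo)%E ->
  countable [set i | a i != 0%E].
Proof.
move=> a0 fin.
have -> : [set i | a i != 0%E] =
    \bigcup_n [set i | ((n.+1%:R)^-1)%:E <= a i]%E.
  apply/seteqP; split => [i /= ai|i [n _ /=] + ]; last first.
    by apply: contraTneq => ->; rewrite -ltNge lte_fin invr_gt0.
  have ai0 : (0 < a i)%E by rewrite lt0e ai a0.
  case ari : (a i) ai0 => [r|//|//]; last by exists 0%N => //=; rewrite ari leey.
  rewrite lte_fin => r0; exists (Num.bound r^-1) => //=.
  rewrite ari lee_fin -[leRHS]invrK lef_pV2 ?posrE ?invr_gt0//.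
  have rV0 : 0 <= r^-1 by rewrite invr_ge0 ltW.
  by rewrite (le_trans (ltW (archi_boundP rV0)))// ler_nat.
apply: bigcup_countable; first exact: countableP.
move=> n _; apply: finite_set_countable; apply: contrapT => inf.
have [M Mf] : exists M : R, (\esum_(i in setT) a i = M%:E)%E.
  exists (fine (\esum_(i in setT) a i)%E); rewrite fineK// ge0_fin_numE//.
  exact: esum_ge0.
(* More than |M|(n+1) terms of size at least 1/(n+1) add up to more than M. *)
have [B BA Bn] := infinite_set_fset (Num.bound (`|M| * n.+1%:R)) inf.
have : (\sum_(i <- B) a i <= M%:E)%E.
  rewrite -Mf; apply: esum_ge; exists [set` B]; first by split.
  by rewrite fsbig_finite//= set_fsetK.
apply/negP; rewrite -ltNge.
apply: (@lt_le_trans _ _ (\sum_(i <- B) ((n.+1%:R)^-1)%:E)%E); last first.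
  by rewrite big_seq [leRHS]big_seq; apply: lee_sum => i /BA.
rewrite sumEFin lte_fin big_const_seq count_predT iter_addr_0.
rewrite -[ltRHS]mulr_natl ltr_pdivlMr//.
apply: (@le_lt_trans _ _ (`|M| * n.+1%:R)); first by rewrite ler_pM2r ?ler_norm.
apply: (lt_le_trans (archi_boundP _)); first by rewrite mulr_ge0.
by rewrite ler_nat.
Qed.

Section countable_pieces.
Context d (T : measurableType d) (R : realType).
Variable mu : {measure set T -> \bar R}.
Variables (I : choiceType) (S : set I) (E : I -> set T).
Hypothesis cS : countable S.
Hypothesis mE : forall i, measurable (E i).
Local Open Scope ereal_scope.

Lemma countable_bigcup_measurable : measurable (\bigcup_(i in S) E i).
Proof.
have [u [-> _ u1]] := countable_partition1 cS.
rewrite bigcup_bigcup; apply: bigcup_measurable => n _.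
by have [->|[i ->]] := u1 n; rewrite ?bigcup_set0 ?bigcup_set1.
Qed.

Lemma measurable_fun_countable_bigcup d' (U : measurableType d') (f : T -> U) :
  (forall i, S i -> measurable_fun (E i) f) ->
  measurable_fun (\bigcup_(i in S) E i) f.
Proof.
have [u [-> _ u1]] := countable_partition1 cS => mf.
rewrite bigcup_bigcup; apply/measurable_fun_bigcup => n.
  by have [->|[i ->]] := u1 n; rewrite ?bigcup_set0 ?bigcup_set1.
have [->|[i uni]] := u1 n; rewrite ?uni ?bigcup_set0 ?bigcup_set1.
  exact: measurable_fun_set0.
by apply: mf; exists n => //; rewrite uni.
Qed.

Lemma countable_bigcup_negligible : (forall i, S i -> mu.-negligible (E i)) ->
  mu.-negligible (\bigcup_(i in S) E i).
Proof.
have [u [-> _ u1]] := countable_partition1 cS => nE.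
rewrite bigcup_bigcup; apply: negligible_bigcup => n.
have [->|[i uni]] := u1 n; rewrite ?uni ?bigcup_set0 ?bigcup_set1.
  exact: negligible_set0.
by apply: nE; exists n => //; rewrite uni.
Qed.

Lemma ge0_integral_countable_bigcup (f : T -> \bar R) : trivIset S E ->
  measurable_fun setT f -> (forall x, 0 <= f x) ->
  \int[mu]_(x in \bigcup_(i in S) E i) f x =
  \esum_(i in S) \int[mu]_(x in E i) f x.
Proof.
move=> tE mf f0; move: tE.
have [u [-> tu u1]] := countable_partition1 cS => tE.
rewrite nneseries_sum_bigcup//; last by move=> i; exact: integral_ge0.
rewrite bigcup_bigcup ge0_integral_bigcup//.
- apply: eq_eseriesr => n _.
  have [->|[i ->]] := u1 n; first by rewrite bigcup_set0 integral_set0 esum_set0.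
  by rewrite bigcup_set1 esum_set1//; exact: integral_ge0.
- by move=> n; have [->|[i ->]] := u1 n; rewrite ?bigcup_set0 ?bigcup_set1.
- exact: measurable_funTS.
- move=> n k _ _ [x [[i ui Eix] [j uj Ejx]]].
  have ij : i = j.
    by apply: tE; [exists n|exists k|exists x].
  by apply: tu => //; exists i; split=> //; rewrite ij.
Qed.

End countable_pieces.

(** The sum is a supremum of finite sums, so integrals are taken over finite unions of the [E i],
    although [I] may be uncountable. *)
Lemma esum_integral_le d (T : measurableType d) (R : realType)
    (mu : {measure set T -> \bar R}) (I : choiceType) (E : I -> set T)
    (f : T -> \bar R) :
  (forall i, measurable (E i)) -> trivIset setT E ->
  measurable_fun setT f -> (forall x, 0 <= f x)%E ->
  (\esum_(i in setT) \int[mu]_(x in E i) f x <= \int[mu]_x f x)%E.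
Proof.
move=> mE tE mf f0; apply: ub_ereal_sup => _ [A [finA _] <-].
have cA := finite_set_countable finA.
rewrite -esum_fset//; last by move=> i _; exact: integral_ge0.
rewrite -ge0_integral_countable_bigcup//; last exact: sub_trivIset tE.
apply: ge0_subset_integral => //; exact: countable_bigcup_measurable.
Qed.

(** * Rectangles in sequence space and the outer measure of unit rectangles *)

Section sequence_space.
Variable R : realType.
Implicit Types C D : nat -> set (measurableTypeR R).

Lemma measurable_coordinate (n : nat) :
  measurable_fun [set: RN R] (fun x : RN R => x n : measurableTypeR R).
Proof.
move=> _ A mA; rewrite setTI; apply: sub_sigma_algebra.
exists n.+1, (fun i => if i == n then A else setT); split.
  by move=> i; case: ifP.
apply/seteqP; split => x /=.
  by move=> Ax i _; case: eqP => // ->.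
by move=> /(_ n (ltnSn n)); rewrite eqxx.
Qed.

Lemma rect_measurable C : (forall i, measurable (C i)) ->
  measurable (rect C : set (RN R)).
Proof.
move=> mC.
have -> : rect C = \bigcap_i ((fun x : RN R => x i : measurableTypeR R) @^-1` C i).
  by apply/seteqP; split => [x Cx i _|x Cx i]; [exact: Cx|exact: (Cx i)].
apply: bigcap_measurableType => i _; rewrite -[X in measurable X]setTI.
exact: measurable_coordinate.
Qed.

Lemma measurable_RN d (T : measurableType d) (F : T -> RN R) :
  (forall n, measurable_fun setT (fun z => F z n : measurableTypeR R)) ->
  measurable_fun setT F.
Proof.
move=> mF; apply: (@measurability _ _ _ _ setT F (@cylinder R)) => //.
move=> _ [_ [m [C [mC ->]]] <-].
have -> : setT `&` F @^-1` [set x | forall i, (i < m)%N -> C i (x i)] =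
    \bigcap_(i in [set k | (k < m)%N]) ((fun z => F z i : measurableTypeR R) @^-1` C i).
  by rewrite setTI; apply/seteqP; split => z.
apply: bigcap_measurableType => i _; rewrite -[X in measurable X]setTI.
exact: mF.
Qed.

Local Open Scope ereal_scope.

Lemma partial_vol_ge0 C n : 0 <= partial_vol C n.
Proof. by apply: prode_ge0 => i _; exact: measure_ge0. Qed.

Lemma partial_vol_nonincreasing C : (forall i, lebesgue_measure (C i) <= 1) ->
  nonincreasing_seq (partial_vol C).
Proof.
move=> C1; apply/nonincreasing_seqP => n.
rewrite /partial_vol big_ord_recr/= -[leRHS]mule1.
by apply: lee_wpmul2l => //; exact: partial_vol_ge0.
Qed.

Lemma vol_le_partial_vol C n : (forall i, lebesgue_measure (C i) <= 1) ->
  vol C <= partial_vol C n.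
Proof.
move=> /partial_vol_nonincreasing/ereal_nonincreasing_cvgn /cvg_lim volE.
by rewrite /vol volE//; apply: ereal_inf_lbound; exists n.
Qed.

Lemma finite_rect_le1 C : (forall i, measurable (C i)) ->
  (forall i, lebesgue_measure (C i) <= 1) -> finite_rect C.
Proof.
move=> mC C1; split=> //.
have := ereal_nonincreasing_cvgn (partial_vol_nonincreasing C1).
set l := ereal_inf _ => Cl; exists (fine l); rewrite fineK//.
have l0 : 0 <= l.
  by apply: le_ereal_inf_tmp => _ [n _ <-]; exact: partial_vol_ge0.
rewrite ge0_fin_numE// (@le_lt_trans _ _ 1) ?ltry//.
by apply: ereal_inf_lbound; exists 0%N => //; rewrite /partial_vol big_ord0.
Qed.

Lemma finite_rect_cvg C : finite_rect C -> cvgn (partial_vol C).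
Proof. by move=> [_ [r Cr]]; apply/cvg_ex; exists r%:E. Qed.

Lemma vol_ge0 C : finite_rect C -> 0 <= vol C.
Proof.
move=> fC; apply: lime_ge; first exact: finite_rect_cvg.
by near=> n; exact: partial_vol_ge0.
Unshelve. all: by end_near. Qed.

Lemma vol_eq1 C : (forall i, lebesgue_measure (C i) = 1) -> vol C = 1.
Proof.
move=> C1; rewrite /vol (_ : partial_vol C = cst 1); first exact: lim_cst.
by apply/funext => n; rewrite /partial_vol big1.
Qed.

Lemma vol_set0 : vol (fun _ => set0 : set (measurableTypeR R)) = 0.
Proof.
apply/cvg_lim => //; apply: cvg_near_cst; near=> n.
have n0 : (0 < n)%N by near: n; exists 1%N.
by rewrite /partial_vol -(prednK n0) big_ord_recl measure0 mul0e.
Unshelve. all: by end_near. Qed.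

(** The rectangle covers itself; the cover is padded with empty rectangles, which are finite and of
    volume 0. *)
Lemma mu_star_rect_le C : finite_rect C -> mu_star (rect C) <= vol C.
Proof.
move=> fC; apply: ereal_inf_lbound.
exists (fun n => if n is 0%N then C else fun=> set0); last first.
  rewrite (nneseries_split 0 1)//; last first.
    by case=> [|n] _; rewrite ?vol_set0// vol_ge0.
  by rewrite big_nat1 eseries0 ?adde0//; case=> // n _ _; exact: vol_set0.
split; last by move=> x Cx; exists 0%N.
by case=> // n; apply: finite_rect_le1 => i //; rewrite measure0 lee01.
Qed.

(** The sum is the integral over [C] of the function in the conclusion; were that function at least
    1 on all of [C], the integral would be at least the measure of [C], which is 1. *)
Lemma weighted_sum_lt1_point (C : set (measurableTypeR R))
    (D : nat -> set (measurableTypeR R)) (c : nat -> \bar R) :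
  measurable C -> lebesgue_measure C = 1 -> (forall n, measurable (D n)) ->
  (forall n, 0 <= c n) ->
  \sum_(0 <= n <oo) c n * lebesgue_measure (C `&` D n) < 1 ->
  exists x, C x /\ \sum_(0 <= n <oo) c n * (\1_(D n) x)%:E < 1.
Proof.
move=> mC C1 mD c0 lt1; apply: contrapT => noP; move: lt1; apply/negP.
rewrite -leNgt.
have term_ge0 n x : 0 <= c n * (\1_(D n) x)%:E by rewrite mule_ge0// lee_fin.
have mterm n : measurable_fun C (fun x => c n * (\1_(D n) x)%:E).
  by apply: measurable_funeM; apply/measurable_EFinP; exact: measurable_indic.
have -> : \sum_(0 <= n <oo) c n * lebesgue_measure (C `&` D n) =
    \int[lebesgue_measure]_(x in C) \sum_(0 <= n <oo) c n * (\1_(D n) x)%:E.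
  rewrite integral_nneseries//; apply: eq_eseriesr => n _.
  rewrite ge0_integralZl//.
  - by rewrite integral_indic// setIC.
  - by apply/measurable_EFinP; exact: measurable_indic.
rewrite -C1 -[leLHS]mul1e -integral_cst//; apply: ge0_le_integral => //.
- exact: ge0_emeasurable_sum.
- move=> x Cx; rewrite leNgt; apply/negP => lt1; apply: noP.
  by exists x.
Qed.

(* The point is built one coordinate at a time: by Fubini some choice of the
   [k]-th coordinate keeps the total weight of the rectangles that are still
   met below [1] *)
Lemma weighted_sum_lt1_sequence C (D : nat -> nat -> set (measurableTypeR R))
    (w : nat -> nat -> \bar R) :
  (forall k, measurable (C k)) -> (forall k, lebesgue_measure (C k) = 1) ->
  (forall n k, measurable (D n k)) -> (forall n k, 0 <= w n k) ->
  (forall n k, w n k = w n k.+1 * lebesgue_measure (C k `&` D n k)) ->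
  \sum_(0 <= n <oo) w n 0%N < 1 ->
  exists x : nat -> R, rect C x /\
    forall n, rect (D n) x -> forall k, w n k < 1.
Proof.
move=> mC C1 mD w0 wS lt1.
(* [b n] stands for the indicator that the first [k] chosen coordinates lie in the sides of [D n],
   and [w n k] for the weight of the coordinates still to come. *)
pose ok k (b : nat -> R) := (forall n, (0 <= b n)%R) /\
  \sum_(0 <= n <oo) (b n)%:E * w n k < 1.
pose upd k (b : nat -> R) (x : R) n := (b n * \1_(D n k) x)%R.
(* The premise [ok] sits inside the existential so that [choice] applies to all pairs; where [ok]
   fails the witness 0 is a dummy. *)
have step kb : exists x, ok kb.1 kb.2 ->
    C kb.1 x /\ ok kb.1.+1 (upd kb.1 kb.2 x).
  case: kb => k b /=; have [[b0 blt]|nok] := pselect (ok k b); last by exists 0%R.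
  have [x [Cx xlt]] : exists x, C k x /\
      \sum_(0 <= n <oo) ((b n)%:E * w n k.+1) * (\1_(D n k) x)%:E < 1.
    apply: weighted_sum_lt1_point => //.
      by move=> n; rewrite mule_ge0// lee_fin.
    by under eq_eseriesr do rewrite -muleA -wS.
  exists x => _; split=> //; split.
    by move=> n; rewrite mulr_ge0.
  rewrite /upd; under eq_eseriesr do rewrite EFinM muleAC.
  exact: xlt.
have [g gP] := choice step.
pose b := fix b k := if k is j.+1 then upd j (b j) (g (j, b j)) else cst 1%R.
have bok k : ok k (b k).
  elim: k => [|k IH]; last by have [] := gP (k, b k) IH.
  split=> [n|]; first exact: ler01.
  by under eq_eseriesr do rewrite mul1e.
exists (fun k => g (k, b k)); split=> [k|n Dx k].
  by have [] := gP (k, b k) (bok k).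
(* If [x] lies in [rect (D n)], every indicator for [n] is 1, so [w n k] is itself a term of a sum
   below 1. *)
have bn k' : b k' n = 1%R.
  elim: k' => // k' IH; rewrite -[LHS]/(upd k' (b k') (g (k', b k')) n).
  by rewrite /upd IH mul1r indicE mem_set//; exact: (Dx k').
have [b0 blt] := bok k.
apply: le_lt_trans blt; rewrite -[leLHS]mul1e -(bn k).
have t0 i : 0 <= (b k i)%:E * w i k by rewrite mule_ge0// lee_fin.
apply: (le_trans _ (nneseries_lim_ge n.+1 _)) => //.
by rewrite big_nat_recr//= leeDr// sume_ge0.
Qed.

(** A cover of total volume below 1 would miss a point of [rect C]. *)
Lemma mu_star_rect_ge1 C : (forall k, measurable (C k)) ->
  (forall k, lebesgue_measure (C k) = 1) -> 1 <= mu_star (rect C).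
Proof.
move=> mC C1; apply: le_ereal_inf_tmp => _ [D [fD cov] <-].
have v0 n : 0 <= vol (D n) by exact: vol_ge0.
rewrite leNgt; apply/negP => lt1.
have sum_fin : \sum_(0 <= n <oo) vol (D n) \is a fin_num.
  by rewrite ge0_fin_numE ?nneseries_ge0// (lt_trans lt1)// ltry.
pose s := fine (\sum_(0 <= n <oo) vol (D n)).
have sE : \sum_(0 <= n <oo) vol (D n) = s%:E by rewrite fineK.
have s1 : (s < 1)%R by rewrite -lte_fin -sE.
(* Stopping after [N n] factors will cost at most e/2^(n+1), hence at most e in total, and s + e <
   1. *)
pose e := ((1 - s) / 2)%R.
have e0 : (0 < e)%R by rewrite divr_gt0// subr_gt0.
have trunc n : exists N, partial_vol (D n) N < vol (D n) + (e / (2 ^ n.+1)%:R)%:E.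
  have [_ [r Dr]] := fD n.
  have vE : vol (D n) = r%:E by exact/cvg_lim.
  have en0 : (0 < e / (2 ^ n.+1)%:R)%R by rewrite divr_gt0// ltr0n expn_gt0.
  apply: contrapT => /forallNP noN.
  have : vol (D n) + (e / (2 ^ n.+1)%:R)%:E <= vol (D n).
    apply: lime_ge; first exact: finite_rect_cvg.
    by apply: nearW => k; rewrite leNgt; apply/negP/noN.
  by rewrite vE -EFinD lee_fin leNgt ltrDl en0.
have [N NP] := choice trunc.
(* Freeing the coordinates from [N n] on enlarges [rect (D n)]. The weight [w n k] is the measure
   left from coordinate [k] on, an empty product beyond [N n]. *)
pose D' n k := if (k < N n)%N then D n k else setT.
pose w n k := \prod_(k <= i < N n) lebesgue_measure (C i `&` D' n i).
have mD n k : measurable (D n k) by have [] := fD n.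
have mD' n k : measurable (D' n k) by rewrite /D'; case: ifP.
have w_ge0 n k : 0 <= w n k.
  by apply: prode_ge0 => i _; exact: measure_ge0.
have wS n k : w n k = w n k.+1 * lebesgue_measure (C k `&` D' n k).
  rewrite /w; have [kN|Nk] := ltnP k (N n).
    by rewrite [LHS]big_ltn// muleC.
  by rewrite !big_geq ?mul1e /D' ?ltnNge ?Nk ?setIT ?C1// (leq_trans Nk).
have w0lt : \sum_(0 <= n <oo) w n 0%N < 1.
  apply: (@le_lt_trans _ _ (s + e)%:E); last first.
    rewrite lte_fin -ltrBrDl /e ltr_pdivrMr// ltr_pMr ?subr_gt0//.
    by rewrite ltr1n.
  rewrite EFinD -sE; apply: le_trans (epsilon_trick xpredT v0 (ltW e0)).
  apply: lee_nneseries => // n _; apply: le_trans (ltW (NP n)).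
  rewrite /w /partial_vol big_mkord.
  suff /andP[] : 0 <= \prod_(i < N n) lebesgue_measure (C i `&` D' n i) <=
    \prod_(i < N n) lebesgue_measure (D n i) by [].
  elim/big_rec2 : _ => [|i x y _ /andP[x0 xy]]; first by rewrite lee01 lexx.
  rewrite mule_ge0//= lee_pmul// le_measure ?inE//; first exact: measurableI.
  by rewrite /D' ltn_ord; exact: subIsetr.
have [x [Cx Dx]] := weighted_sum_lt1_sequence mC C1 mD' w_ge0 wS w0lt.
have [n _ Dnx] := cov x Cx.
have D'x : rect (D' n) x by move=> k; rewrite /D'; case: ifP => // _; exact: Dnx.
(* At [k = N n] the weight is the empty product 1, which is not below 1. *)
by have := Dx n D'x (N n); rewrite /w big_geq// ltxx.
Qed.

Lemma le_mu_star (pi : {measure set (RN R) -> \bar R}) (A : set (RN R)) :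
  (forall D, finite_rect D -> pi (rect D) <= vol D) -> measurable A ->
  pi A <= mu_star A.
Proof.
move=> piD mA; apply: le_ereal_inf_tmp => _ [D [fD cov] <-].
have mD n : measurable (rect (D n) : set (RN R)).
  by apply: rect_measurable; have [] := fD n.
apply: le_trans (measure_sigma_subadditive pi mD mA cov) _.
by apply: lee_nneseries => // n _; exact: piD.
Qed.

End sequence_space.

(** * Comparison of measures, and overwriting of the first coordinate *)

(** A deficit of [pi] against [m] on the part of [A] in [E] cannot be made up on the rest of [E],
    where again [pi] is below [m]; it would give [pi E < m E]. *)
Lemma le_measure_eq_restr d (T : measurableType d) (R : realType)
    (m pi : {measure set T -> \bar R}) (E A : set T) :
  measurable E -> (forall B, measurable B -> pi B <= m B)%E ->
  pi (~` E) = 0%E -> (m E <= pi E)%E -> (m E < +oo)%E -> measurable A ->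
  pi A = m (A `&` E).
Proof.
move=> mE pim piCE mpi mEfin mA.
have mAE : measurable (A `&` E) by exact: measurableI.
have mEA : measurable (E `\` A) by exact: measurableD.
have piAE : pi A = pi (A `&` E).
  rewrite [LHS](measureDI pi mA mE)/= [X in (X + _)%E](_ : _ = 0%E) ?add0e//.
  apply/eqP; rewrite eq_le measure_ge0 andbT -piCE; apply: le_measure; rewrite ?inE.
  - exact: measurableD.
  - exact: measurableC.
  - by move=> x [].
rewrite piAE; apply/eqP; rewrite eq_le pim//= leNgt; apply/negP => lt.
suff : (pi E < m E)%E by rewrite ltNge mpi.
rewrite (measureDI pi mE mA) (measureDI m mE mA) (setIC E A) lee_ltD//.
- rewrite ge0_fin_numE// (le_lt_trans (pim _ mEA))//.
  by rewrite (le_lt_trans _ mEfin)// le_measure ?inE//; exact: subDsetl.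
- exact: pim.
Qed.

Lemma le_measureIl d (T : measurableType d) (R : realType)
    (mu : {measure set T -> \bar R}) (A B : set T) :
  measurable A -> measurable B -> (mu (A `&` B) <= mu A)%E.
Proof.
by move=> mA mB; apply: le_measure; rewrite ?inE//; exact: measurableI.
Qed.

Section head_replacement.
Variable R : realType.

(** The tail comes from a full sequence whose coordinate 0 is discarded, so that [m] itself,
    restricted to a rectangle, can serve as the law of the tail. *)
Definition set_head (z : measurableTypeR R * RN R) : RN R :=
  fun n => if n is 0%N then z.1 else z.2 n.

Lemma measurable_set_head : measurable_fun setT set_head.
Proof.
apply: measurable_RN => -[|n] /=; first exact: measurable_fst.
exact: (measurableT_comp (measurable_coordinate n.+1) measurable_snd).
Qed.

Lemma lebesgue_measure01_lty :
  (lebesgue_measure (`[0%R, 1%R] : set (measurableTypeR R)) < +oo)%E.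
Proof. by rewrite lebesgue_measure_itv/= lte_fin ltr01 ltry. Qed.

Definition finite_lambda01 : {finite_measure set (measurableTypeR R) -> \bar R} :=
  @mfrestr _ (measurableTypeR R) R _ (@lebesgue_measure R)
    (measurable_itv `[0%R, 1%R]) lebesgue_measure01_lty.

End head_replacement.

(** * The product structure of the measure on a unit rectangle *)

Section unit_rectangle.
Variables (R : realType) (m : {measure set (RN R) -> \bar R}).
Hypothesis hm : forall A : set (RN R), measurable A -> m A = mu_star A.
Variable C : nat -> set (measurableTypeR R).
Hypothesis mC : forall k, measurable (C k).
Hypothesis C0 : C 0%N = `[0%R, 1%R]%classic.
Hypothesis C1 : forall k, lebesgue_measure (C k) = 1%E.
Local Open Scope ereal_scope.

Lemma measure_unit_rect : m (rect C) = 1.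
Proof.
rewrite hm; last exact: rect_measurable.
apply/eqP; rewrite eq_le mu_star_rect_ge1// andbT -[leRHS](vol_eq1 C1).
by apply: mu_star_rect_le; apply: finite_rect_le1 => // i; rewrite C1.
Qed.

Lemma measure_unit_rect_lty : m (rect C) < +oo.
Proof. by rewrite measure_unit_rect ltry. Qed.

Definition unit_rect_measure : {finite_measure set (RN R) -> \bar R} :=
  mfrestr (rect_measurable mC) measure_unit_rect_lty.

Lemma unit_rect_measureT : unit_rect_measure setT = 1.
Proof. by rewrite /= /mfrestr /mrestr setTI measure_unit_rect. Qed.

(** The preimage is the product of [D 0] and a rectangle free in coordinate 0. Its measure is that
    of [D 0] within [0, 1] times [m (rect C')]. As [C' 0] has length 1, the partial volumes compare
    factor by factor. *)
Lemma product_set_head_rect_le (D : nat -> set (measurableTypeR R)) :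
  finite_rect D ->
  (finite_lambda01 R \x unit_rect_measure) (@set_head R @^-1` rect D) <= vol D.
Proof.
move=> fD; have [mD _] := fD.
pose D1 n := if n is 0%N then setT else D n.
pose C' n := if n is 0%N then C 0%N else D n `&` C n.
have mD1 n : measurable (D1 n) by case: n => //= n; exact: mD.
have mC' n : measurable (C' n).
  by case: n => [|n] /=; [exact: mC|exact: measurableI].
have C'1 n : lebesgue_measure (C' n) <= 1.
  case: n => [|n] /=; first by rewrite C1.
  by rewrite -(C1 n.+1) setIC le_measureIl.
have -> : @set_head R @^-1` rect D = D 0%N `*` (rect D1 : set (RN R)).
  apply/seteqP; split => -[a y] /=.
    by move=> Dz; split; [exact: (Dz 0%N)|case=> // n; exact: (Dz n.+1)].
  by move=> [Da Dy] [|n] //=; exact: (Dy n.+1).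
rewrite product_measure1E//; last exact: rect_measurable.
rewrite /= /mfrestr /mrestr.
have -> : rect D1 `&` rect C = rect C'.
  apply/seteqP; split => y /=.
    by move=> [Dy Cy] [|n] /=; [exact: Cy|split; [exact: (Dy n.+1)|exact: Cy]].
  move=> C'y; split=> k; first by case: k => // k; have [] := C'y k.+1.
  by case: k => [|k]; [exact: (C'y 0%N)|have [] := C'y k.+1].
have fC' : finite_rect C' by exact: finite_rect_le1.
set l := lebesgue_measure _.
have l0 : 0 <= l by exact: measure_ge0.
have lfin : l \is a fin_num.
  rewrite ge0_fin_numE// (le_lt_trans _ (lebesgue_measure01_lty R))//.
  by rewrite /l setIC le_measureIl.
apply: (@le_trans _ _ (l * vol C')).
  apply: lee_wpmul2l => //; rewrite hm; last exact: rect_measurable.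
  exact: mu_star_rect_le.
have C'cv := finite_rect_cvg fC'.
have lC'cv : (fun n => l * partial_vol C' n) @ \oo --> l * vol C'.
  exact: cvgeZl.
rewrite -(cvg_lim (@ereal_hausdorff R) lC'cv).
apply: lee_lim; [by apply/cvg_ex; eexists; exact: lC'cv|exact: finite_rect_cvg|].
near=> n.
have n0 : (0 < n)%N by near: n; exists 1%N.
rewrite /partial_vol -(prednK n0) !big_ord_recl/= C1 mul1e.
apply: lee_pmul => //.
- by apply: prode_ge0 => i _; exact: measure_ge0.
- exact: le_measureIl.
- have mDI i : measurable (D i `&` C i) by exact: measurableI.
  suff /andP[] : 0 <= \prod_(i < n.-1) lebesgue_measure (D (bump 0 i) `&` C (bump 0 i)) <=
    \prod_(i < n.-1) lebesgue_measure (D (bump 0 i)) by [].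
  elim/big_rec2 : _ => [|i x y _ /andP[x0 xy]]; first by rewrite lee01 lexx.
  by rewrite mule_ge0//= lee_pmul// le_measureIl.
Unshelve. all: by end_near. Qed.

Let pi : {measure set (RN R) -> \bar R} :=
  measure_function_pushforward__canonical__measure_function_Measure
    (finite_lambda01 R \x unit_rect_measure) (@measurable_set_head R).

Lemma product_set_head (A : set (RN R)) : measurable A ->
  (finite_lambda01 R \x unit_rect_measure) (@set_head R @^-1` A) = m (A `&` rect C).
Proof.
have mE := rect_measurable mC.
have piE : pi (rect C) = 1.
  rewrite /= /pushforward.
  have -> : @set_head R @^-1` rect C =
      C 0%N `*` [set y : RN R | forall n, C n.+1 (y n.+1)].
    apply/seteqP; split => -[a y] /=.
      by move=> Cz; split; [exact: (Cz 0%N)|move=> n; exact: (Cz n.+1)].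
    by move=> [Ca Cy] [|n] //=.
  have mE1 : measurable [set y : RN R | forall n, C n.+1 (y n.+1)].
    rewrite (_ : [set y | _] = rect (fun n => if n is 0%N then setT else C n)).
      by apply: rect_measurable; case.
    by apply/seteqP; split => y /= Cy; [case=> // n|move=> n; exact: (Cy n.+1)].
  rewrite product_measure1E//= /mfrestr /mrestr C0 setIid.
  rewrite lebesgue_measure_itv/= lte_fin ltr01 oppr0 adde0 mul1e.
  rewrite setIidr ?measure_unit_rect// => y Cy n; exact: Cy.
have pi_le B : measurable B -> pi B <= m B.
  by move=> mB; rewrite hm//; apply: le_mu_star => // D; exact: product_set_head_rect_le.
have piT : pi setT = 1.
  rewrite /= /pushforward preimage_setT -setXTT product_measure1E//.
  rewrite /= /mfrestr /mrestr !setTI measure_unit_rect mule1.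
  by rewrite lebesgue_measure_itv/= lte_fin ltr01 oppr0 adde0.
(* [pi] lies below [m], and both give [rect C] mass 1; as [pi] has total mass 1, the complement of
   [rect C] is [pi]-null. *)
move=> mA; apply: (@le_measure_eq_restr _ _ _ m pi) => //.
- by rewrite -setTD measureD//= ?setTI; rewrite -?/(pi _) ?piE ?piT ?subee ?ltry.
- by rewrite piE measure_unit_rect.
- exact: measure_unit_rect_lty.
Qed.

Lemma ge0_integral_set_head (f : RN R -> \bar R) :
  measurable_fun setT f -> (forall y, 0 <= f y) ->
  \int[finite_lambda01 R \x unit_rect_measure]_z f (set_head z) =
  \int[m]_(y in rect C) f y.
Proof.
move=> mf f0; rewrite -(ge0_integral_mrestr m (rect_measurable mC))//.
have := @ge0_integral_pushforward _ _ _ _ _ _ (@measurable_set_head R)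
  (finite_lambda01 R \x unit_rect_measure) setT f measurableT mf (fun y _ => f0 y).
rewrite preimage_setT => <-.
apply: (@eq_measure_integral _ _ _ _ (mrestr m (rect_measurable mC)) pi) => A mA _.
by rewrite /= /pushforward /mrestr product_set_head.
Qed.

(** By Tonelli: after the change of variables the integrand depends on [z.1] alone, and the second
    factor has mass 1. *)
Lemma ge0_integral_unit_rect_head (h : measurableTypeR R -> \bar R) :
  measurable_fun setT h -> (forall x, 0 <= h x) ->
  \int[m]_(y in rect C) h (y 0%N) = \int[lambda01 R]_x h x.
Proof.
move=> mh h0.
have mhy : measurable_fun [set: RN R] (fun y : RN R => h (y 0%N)).
  exact: (measurableT_comp mh (measurable_coordinate 0%N)).
rewrite -(ge0_integral_set_head mhy)//=.
rewrite (fubini_tonelli1 (fun z : measurableTypeR R * RN R => h z.1))//; last first.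
  exact: (measurableT_comp mh measurable_fst).
apply: eq_integral => x _; rewrite /fubini_F/= integral_cst//.
by rewrite /= /mfrestr /mrestr setTI measure_unit_rect mule1.
Qed.

Lemma measure_unit_rect_head (A : set (measurableTypeR R)) : measurable A ->
  m (rect C `&` [set y | A (y 0%N)]) = lambda01 R A.
Proof.
move=> mA; have mhead : measurable [set y : RN R | A (y 0%N)].
  by rewrite -[X in measurable X]setTI; exact: (measurable_coordinate 0%N).
rewrite setIC -product_set_head//.
have -> : @set_head R @^-1` [set y | A (y 0%N)] = A `*` setT.
  by apply/seteqP; split => -[a y] //= [].
by rewrite product_measure1E// /= /mfrestr /mrestr setTI measure_unit_rect mule1.
Qed.

End unit_rectangle.

(** * The disjoint shifted cubes *)

Section shifted_cubes.
Variable R : realType.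

(** The sides with n >= 1 encode [i], and the shift by 1/2 makes each of them straddle an integer.
    Side 0 is the interval of [lambda01], where the embedded functions live. *)
Definition shift_side (i : R) (n : nat) : set (measurableTypeR R) :=
  if n is 0%N then `[0, 1]
  else `[(Num.floor (i * n%:R))%:~R + 2^-1, (Num.floor (i * n%:R))%:~R + 2^-1 + 1[.

Definition shift_cube (i : R) : set (RN R) := rect (shift_side i).

Lemma shift_side_measurable i n : measurable (shift_side i n).
Proof. by case: n => [|n]; exact: measurable_itv. Qed.

Lemma shift_side_measure i n : lebesgue_measure (shift_side i n) = 1%E.
Proof.
case: n => [|n]; rewrite /shift_side lebesgue_measure_itv/= lte_fin.
  by rewrite ltr01 oppr0 adde0.
by rewrite ltrDl ltr01 -EFinD addrAC subrr add0r.
Qed.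

Lemma shift_cube_measurable i : measurable (shift_cube i).
Proof. by apply: rect_measurable; exact: shift_side_measurable. Qed.

(** A common point gives floor(i n) = floor(j n) for all n >= 1, hence |i - j| n < 1 for all n. *)
Lemma shift_cube_disjoint : trivIset setT shift_cube.
Proof.
move=> i j _ _ [y [Ei Ej]].
have floorE n : Num.floor (i * n.+1%:R) = Num.floor (j * n.+1%:R).
  have := Ei n.+1; have := Ej n.+1.
  rewrite /shift_side /= !in_itv /= => /andP[j1 j2] /andP[i1 i2].
  apply/eqP; rewrite eq_le -!ltzD1 -!(ltr_int R) !intrD.
  by apply/andP; split; lra.
wlog ij : i j {Ei Ej} floorE / i <= j.
  by move=> H; have [/H->//|/ltW /H ->] := leP i j.
apply/eqP; rewrite eq_le ij /= leNgt; apply/negP => lt_ij.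
have d0 : 0 < j - i by rewrite subr_gt0.
have := archi_boundP (ltW (_ : 0 < (j - i)^-1)).
rewrite invr_gt0 => /(_ d0).
(* [N] exceeds 1/(j - i), so i(N+1) and j(N+1) differ by more than 1. *)
set N := Num.bound _ => NP.
have := floorE N => /(congr1 (fun z : int => z%:~R : R)) fE.
have := ge_floor (i * N.+1%:R); have := lt_succ_floor (i * N.+1%:R).
have := ge_floor (j * N.+1%:R); have := lt_succ_floor (j * N.+1%:R).
rewrite !intrD fE => h1 h2 h3 h4.
have : 1 < (j - i) * N.+1%:R.
  rewrite -ltr_pdivrMl// mulr1 (lt_le_trans NP)// ler_nat.
  exact: leqnSn.
rewrite mulrBl; lra.
Qed.

Definition cube_side (a : nat -> int) (n : nat) : set (measurableTypeR R) :=
  `[(a n)%:~R, (a n)%:~R + 1[.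

Lemma cubeE a : cube a = rect (cube_side a) :> set (RN R).
Proof.
by apply/seteqP; split => y /= ay n; have := ay n; rewrite /cube_side /= in_itv.
Qed.

Lemma cube_measurable a : measurable (cube a : set (RN R)).
Proof. by rewrite cubeE; apply: rect_measurable => n; exact: measurable_itv. Qed.

(* A half-integer interval of length 1 is split in halves by the integers *)
Lemma shift_side_cube_side i a n :
  (lebesgue_measure (shift_side i n.+1 `&` cube_side a n.+1) <= (2^-1)%:E)%E.
Proof.
set k := Num.floor (i * n.+1%:R).
have mI : measurable (shift_side i n.+1 `&` cube_side a n.+1).
  by apply: measurableI; [exact: shift_side_measurable|exact: measurable_itv].
(* The integer k + 1 halves the side: the cube can meet only the lower half if [a n.+1 <= k], and
   only the upper half otherwise. *)
have [ak|ka] := leP (a n.+1) k.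
- apply: (@le_trans _ _ (lebesgue_measure
      (`[k%:~R + 2^-1, k%:~R + 1[ : set (measurableTypeR R)))).
    apply: le_measure; rewrite ?inE//.
    move=> x []; rewrite /shift_side /cube_side /= !in_itv /= -/k.
    move=> /andP[h1 h2] /andP[h3 h4].
    move: ak; rewrite -(ler_int R) => ak.
    by apply/andP; split=> //; lra.
  rewrite lebesgue_measure_itv/= lte_fin ltrD2l ifT; last lra.
  by rewrite -EFinD lee_fin; lra.
- apply: (@le_trans _ _ (lebesgue_measure
      (`[k%:~R + 1, k%:~R + 2^-1 + 1[ : set (measurableTypeR R)))).
    apply: le_measure; rewrite ?inE//.
    move=> x []; rewrite /shift_side /cube_side /= !in_itv /= -/k.
    move=> /andP[h1 h2] /andP[h3 h4].
    move: ka; rewrite -lezD1 -(ler_int R) intrD => ka.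
    by apply/andP; split=> //; lra.
  rewrite lebesgue_measure_itv/= lte_fin ifT; last lra.
  by rewrite -EFinD lee_fin; lra.
Qed.

(** Side 0 contributes at most 1 and every other side at most 1/2, so the first n + 1 factors have
    product at most 2^-n. *)
Lemma shift_cube_cube_null (m : {measure set (RN R) -> \bar R}) :
  (forall A : set (RN R), measurable A -> m A = mu_star A) ->
  forall i a, m (shift_cube i `&` cube a) = 0%E.
Proof.
move=> hm i a; pose D n := shift_side i n `&` cube_side a n.
have mD n : measurable (D n).
  by apply: measurableI; [exact: shift_side_measurable|exact: measurable_itv].
have DE : shift_cube i `&` cube a = rect D.
  rewrite cubeE; apply/seteqP; split => [y [h1 h2] n|y Dy].
    by split; [exact: h1|exact: h2].
  by split=> n; have [] := Dy n.
have D1 n : (lebesgue_measure (D n) <= 1)%E.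
  rewrite -(shift_side_measure i n) le_measureIl//.
    exact: shift_side_measurable.
  exact: measurable_itv.
have fD := finite_rect_le1 mD D1.
rewrite DE hm; last exact: rect_measurable.
apply/eqP; rewrite eq_le; apply/andP; split; last first.
  by rewrite -hm ?measure_ge0//; exact: rect_measurable.
apply: (le_trans (mu_star_rect_le fD)).
have pD n : (partial_vol D n.+1 <= (2^-1 ^+ n)%:E)%E.
  elim: n => [|n IH]; first by rewrite /partial_vol big_ord1 expr0.
  rewrite /partial_vol big_ord_recr/= exprSr EFinM lee_pmul//.
  - exact: partial_vol_ge0.
  - exact: shift_side_cube_side.
have half0 : limn (fun n => (2^-1 ^+ n : R)%:E) = 0%E.
  apply/cvg_lim => //; apply: cvg_EFin; first exact: nearW.
  by apply: cvg_expr; rewrite ger0_norm; lra.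
rewrite -half0; apply: lime_ge.
  apply/cvg_ex; exists 0%E; apply: cvg_EFin; first exact: nearW.
  by apply: cvg_expr; rewrite ger0_norm; lra.
by apply: nearW => n; apply: le_trans (pD n); exact: vol_le_partial_vol.
Qed.

End shifted_cubes.

(** * The isometric embedding *)

Section embedding.
Variables (R : realType) (m : {measure set (RN R) -> \bar R}).
Hypothesis hm : forall A : set (RN R), measurable A -> m A = mu_star A.
Variable p : R.
Hypothesis p1 : 1 <= p.
Local Open Scope ereal_scope.
Implicit Types (g h : R -> measurableTypeR R -> R) (f : RN R -> R).
Local Notation mside := (@shift_side_measurable R _).
Local Notation E := (@shift_cube R).

Let p0 : (0 < p)%R. Proof. exact: lt_le_trans ltr01 p1. Qed.

Definition energy g (i : R) : \bar R := \int[lambda01 R]_x (`|g i x| `^ p)%:E.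

Definition active g : set R := [set i | energy g i != 0].

(** For [g] in the l^p-sum the active indices are countably many, which makes this function
    measurable; a union of uncountably many [E i] might not be. The index found by [xget] is unique
    by disjointness, and its default 0 is never reached. *)
Definition embed g (y : RN R) : R :=
  if `[< (\bigcup_(i in active g) E i) y >]
  then g (xget 0%R [set i | E i y]) (y 0%N) else 0%R.

Lemma energy_ge0 g i : 0 <= energy g i.
Proof. by apply: integral_ge0 => x _; rewrite lee_fin powR_ge0. Qed.

Lemma ellp_normE g : ellp_norm p g = (\esum_(i in setT) energy g i) `^ p^-1.
Proof.
by rewrite /ellp_norm; congr (_ `^ _); apply: eq_esum => i _; rewrite Lnorm_powE.
Qed.

Lemma ellpP g : ellp p g <->
  (forall i, measurable_fun setT (g i)) /\ \esum_(i in setT) energy g i < +oo.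
Proof.
have pV0 : (p^-1 != 0)%R by rewrite invr_neq0// gt_eqF//.
split=> [[Lg]|[mg fin]].
  rewrite ellp_normE => /(lty_poweRy pV0) ?; split=> // i.
  by have /Lfun_integralP[] := Lg i.
split; last by rewrite ellp_normE poweR_lty.
move=> i; apply/Lfun_integralP => //; split=> //.
rewrite (le_lt_trans _ fin)//; apply: esum_ge; exists [set i].
  by split=> //; exact: finite_set1.
by rewrite fsbig_set1.
Qed.

Lemma active_countable g : ellp p g -> countable (active g).
Proof.
move=> /ellpP[_ fin]; apply: countable_esum_support fin; exact: energy_ge0.
Qed.

Lemma index_unique i y : E i y -> xget 0%R [set i | E i y] = i.
Proof.
move=> Eiy; apply: (@shift_cube_disjoint R) => //; exists y; split=> //.
by apply: (@xgetPex _ 0%R [set i | E i y]); exists i.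
Qed.

Lemma embed_active g i y : active g i -> E i y -> embed g y = g i (y 0%N).
Proof.
move=> gi Eiy; rewrite /embed asboolT; last by exists i.
by rewrite (index_unique Eiy).
Qed.

Lemma embed_inactive g i y : ~ active g i -> E i y -> embed g y = 0%R.
Proof.
move=> gi Eiy; rewrite /embed asboolF// => -[j gj Ejy]; apply: gi.
by rewrite -(index_unique Eiy) (index_unique Ejy).
Qed.

Lemma embed_outside g y : ~ (\bigcup_(i in active g) E i) y -> embed g y = 0%R.
Proof. by move=> ny; rewrite /embed asboolF. Qed.

Lemma measurable_embed g : countable (active g) ->
  (forall i, measurable_fun setT (g i)) -> measurable_fun setT (embed g).
Proof.
move=> cg mg.
have mU := countable_bigcup_measurable cg (@shift_cube_measurable R).
rewrite -(setUv (\bigcup_(i in active g) E i)); apply/measurable_funU => //.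
  exact: measurableC.
split.
  apply: measurable_fun_countable_bigcup => // [i|i gi].
    exact: shift_cube_measurable.
  apply: (@eq_measurable_fun _ _ _ _ _ (fun y : RN R => g i (y 0%N))).
    by move=> y; rewrite inE => Eiy; rewrite (embed_active gi Eiy).
  apply: measurable_funTS.
  exact: (measurableT_comp (mg i) (measurable_coordinate 0%N)).
apply: (@eq_measurable_fun _ _ _ _ _ (fun _ : RN R => 0%R : R)); last first.
  exact: measurable_cst.
by move=> y; rewrite inE => ny; rewrite embed_outside.
Qed.

Lemma integral_shift_cube_embed g i : (forall i, measurable_fun setT (g i)) ->
  \int[m]_(y in E i) (`|embed g y| `^ p)%:E = energy g i.
Proof.
move=> mg; have [gi|gi] := pselect (active g i); last first.
  rewrite [RHS](_ : _ = 0); last by apply/eqP/negPn/negP.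
  apply: integral0_eq => y Eiy.
  by rewrite (embed_inactive gi Eiy) normr0 powR0// gt_eqF//.
rewrite (eq_integral (fun y : RN R => (`|g i (y 0%N)| `^ p)%:E)); last first.
  by move=> y; rewrite inE => Eiy; rewrite (embed_active gi Eiy).
apply: (ge0_integral_unit_rect_head hm mside erefl (@shift_side_measure R i)
   (h := fun x => (`|g i x| `^ p)%:E)).
- exact: measurable_norm_powR.
- by move=> x; rewrite lee_fin powR_ge0.
Qed.

Lemma integral_embed g : ellp p g ->
  \int[m]_y (`|embed g y| `^ p)%:E = \esum_(i in setT) energy g i.
Proof.
move=> eg; have cg := active_countable eg; have [mg _] := (ellpP g).1 eg.
have mU := countable_bigcup_measurable cg (@shift_cube_measurable R).
have mJ := measurable_norm_powR p (measurable_embed cg mg).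
transitivity (\int[m]_(y in \bigcup_(i in active g) E i) (`|embed g y| `^ p)%:E).
  rewrite [RHS]integral_mkcond; apply: eq_integral => y _.
  rewrite patchE; case: ifPn => //; rewrite notin_setE => /embed_outside ->.
  by rewrite normr0 powR0// gt_eqF//.
rewrite ge0_integral_countable_bigcup//.
- rewrite esum_mkcond; apply: eq_esum => i _.
  rewrite integral_shift_cube_embed//; case: ifPn => //; rewrite notin_setE => gi.
  by apply/esym/eqP/negPn/negP.
- exact: shift_cube_measurable.
- exact: sub_trivIset (@shift_cube_disjoint R).
Qed.

Lemma embed_Lfun g : ellp p g -> embed g \in Lfun m p%:E.
Proof.
move=> eg; have [mg fin] := (ellpP g).1 eg; apply/Lfun_integralP => //.
rewrite integral_embed//; split=> //.
by apply: measurable_embed => //; exact: active_countable.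
Qed.

(** Each cube meets the countably many active pieces in null sets, and the function vanishes off
    these pieces. *)
Lemma embed_Bp g : ellp p g -> Bp m p (embed g).
Proof.
move=> eg; split; first exact: embed_Lfun.
move=> a; have cg := active_countable eg; have [mg _] := (ellpP g).1 eg.
pose Z := \bigcup_(i in active g) (E i `&` cube a).
have mEa i : measurable (E i `&` cube a).
  by apply: measurableI; [exact: shift_cube_measurable|exact: cube_measurable].
have mZ : measurable Z by exact: countable_bigcup_measurable.
have mZ0 : m Z = 0.
  apply: (measure_negligible mZ); apply: countable_bigcup_negligible => // i _.
  by apply/negligibleP => //; exact: shift_cube_cube_null.
rewrite (ge0_negligible_integral mZ)//; last 2 first.
- exact: cube_measurable.
- by apply/measurable_norm_powR/measurable_funTS; exact: measurable_embed.
apply: integral0_eq => y [ay nZy].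
rewrite embed_outside ?normr0 ?powR0 ?gt_eqF// => -[i gi Eiy].
by apply: nZy; exists i.
Qed.

Lemma Lnorm_embed g : ellp p g ->
  'N[m]_(p%:E)[EFin \o embed g] = ellp_norm p g.
Proof. by move=> eg; rewrite LnormE_integral integral_embed// ellp_normE. Qed.

Lemma shift_cube_head_negligible i (N : set (measurableTypeR R)) :
  (lambda01 R).-negligible N -> m.-negligible (E i `&` [set y | N (y 0%N)]).
Proof.
move=> [A [mA A0 NA]].
exists (E i `&` [set y | A (y 0%N)]); split.
- apply: measurableI; first exact: shift_cube_measurable.
  by rewrite -[X in measurable X]setTI; exact: (measurable_coordinate 0%N).
- by rewrite (measure_unit_rect_head hm mside erefl (@shift_side_measure R i)).
- by move=> y [Ey Ny]; split=> //; exact: NA.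
Qed.

Lemma inactive_negligible g i : measurable_fun setT (g i) -> ~ active g i ->
  (lambda01 R).-negligible [set x | g i x != 0%R].
Proof.
move=> mgi gi; have e0 : energy g i = 0 by apply/eqP/negPn/negP.
have N0 : 'N[lambda01 R]_(p%:E)[EFin \o g i] = 0.
  rewrite LnormE_integral -/(energy g i) e0 poweR0r// invr_neq0// gt_eqF//.
have /measurable_EFinP mEgi := mgi.
have := Lnorm_eq0_eq0 mEgi _ N0; rewrite lte_fin => /(_ p0).
case=> A [mA A0 nA]; exists A; split=> // x /= gx; apply: nA => /= /(_ I) [].
by move/eqP; rewrite (negbTE gx).
Qed.

Lemma embed_negligible g i : measurable_fun setT (g i) ->
  m.-negligible (E i `&` [set y | embed g y != g i (y 0%N)]).
Proof.
move=> mgi; have [gi|gi] := pselect (active g i).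
  apply: negligibleS (negligible_set0 m) => y [Ey] /=.
  by rewrite (embed_active gi Ey) eqxx.
apply: negligibleS (shift_cube_head_negligible i (inactive_negligible mgi gi)).
by move=> y [Ey] /=; rewrite (embed_inactive gi Ey) eq_sym.
Qed.

(** Reduces equality almost everywhere to each piece: off the countably many pieces of [active g]
    and [S] both functions vanish, so the exceptional sets have a null union. *)
Lemma embed_ae_eq g f (S : set R) : countable (active g) -> countable S ->
  (forall i, measurable_fun setT (g i)) ->
  (forall y, ~ (\bigcup_(i in S) E i) y -> f y = 0%R) ->
  (forall i, m.-negligible (E i `&` [set y | f y != g i (y 0%N)])) ->
  embed g = f %[ae m].
Proof.
move=> cg cS mg fS fg.
have cU : countable (active g `|` S) by exact: countable_setU.
have : m.-negligible (\bigcup_(i in active g `|` S)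
    (E i `&` [set y | embed g y != f y])).
  apply: countable_bigcup_negligible => // i _.
  apply: negligibleS (negligibleU (embed_negligible (mg i)) (fg i)).
  move=> y [Ey] /= neq.
  have [fy|fy] := eqVneq (f y) (g i (y 0%N)); last by right.
  by left; split=> //=; rewrite -fy.
apply: negligibleS => y /= neq.
have {}neq : embed g y != f y by apply/eqP => eq_y; apply: neq => _.
have [[i gi Ey]|ng] := pselect ((\bigcup_(i in active g) E i) y).
  by exists i => //; left.
have [[i Si Ey]|nS] := pselect ((\bigcup_(i in S) E i) y).
  by exists i => //; right.
by move: neq; rewrite (fS _ nS) (embed_outside ng) eqxx.
Qed.

Lemma embed_linear g h (a : R) : ellp p g -> ellp p h ->
  embed (fun i x => a * g i x + h i x)%R =
  (fun y => a * embed g y + embed h y)%R %[ae m].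
Proof.
move=> eg eh; have [mg _] := (ellpP g).1 eg; have [mh _] := (ellpP h).1 eh.
have mgh i : measurable_fun setT (fun x => a * g i x + h i x)%R.
  by apply: measurable_funD => //; exact: measurable_funM.
have cS : countable (active g `|` active h).
  by apply: countable_setU; exact: active_countable.
apply: (embed_ae_eq (S := active g `|` active h)) => //.
(* Where [g i] and [h i] are both inactive, the combination vanishes almost everywhere and is
   inactive too. *)
- apply: sub_countable cS; apply: subset_card_le => i; apply: contraPP.
  move=> /not_orP[gi hi] /=; apply/negP/negPn/eqP.
  rewrite /energy (ae_eq_integral (cst 0)) ?integral0//.
    exact: measurable_norm_powR.
  apply: negligibleS (negligibleU (inactive_negligible (mg i) gi)
    (inactive_negligible (mh i) hi)) => x /= neq.
  have [gx|gx] := eqVneq (g i x) 0%R; last by left.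
  have [hx|hx] := eqVneq (h i x) 0%R; last by right.
  exfalso; apply: neq => _; rewrite gx hx mulr0 addr0 normr0 powR0// gt_eqF//.
- move=> y nS; rewrite !embed_outside ?mulr0 ?addr0// => -[i gi Ey]; apply: nS.
    by exists i => //; right.
  by exists i => //; left.
- move=> i.
  apply: negligibleS (negligibleU (embed_negligible (mg i)) (embed_negligible (mh i))).
  move=> y [Ey] /= neq.
  have [gy|gy] := eqVneq (embed g y) (g i (y 0%N)); last by left.
  right; split=> //=; apply: contra_neq neq => ->; by rewrite gy.
Qed.

(** * The projection by averaging *)

(** The conditional expectation of [f] on [E i] given coordinate 0, the tail being drawn from [m] on
    [E i]. *)
Definition average f (i : R) : measurableTypeR R -> R :=
  section_average (unit_rect_measure hm (@shift_side_measurable R i)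
    (@shift_side_measure R i)) (fun z => f (set_head z)).

Section average_Lp.
Variable f : RN R -> R.
Hypothesis Lf : f \in Lfun m p%:E.

Let mf : measurable_fun setT f.
Proof. by have /(Lfun_integralP _ _ p1)[] := Lf. Qed.

Let mfp : measurable_fun setT (fun y => (`|f y| `^ p)%:E).
Proof. exact: measurable_norm_powR. Qed.

Lemma measurable_comp_set_head :
  measurable_fun setT (fun z => f (@set_head R z)).
Proof. exact: (measurableT_comp mf (@measurable_set_head R)). Qed.

Lemma integral_set_head_powR i :
  \int[finite_lambda01 R \x unit_rect_measure hm (@shift_side_measurable R i)
    (@shift_side_measure R i)]_z (`|f (set_head z)| `^ p)%:E =
  \int[m]_(y in E i) (`|f y| `^ p)%:E.
Proof.
apply: (ge0_integral_set_head hm (@shift_side_measurable R i) erefl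
  (@shift_side_measure R i) mfp) => y.
by rewrite lee_fin powR_ge0.
Qed.

Lemma integral_shift_cube_lty i : \int[m]_(y in E i) (`|f y| `^ p)%:E < +oo.
Proof.
have /(Lfun_integralP _ _ p1)[_] := Lf; apply: le_lt_trans.
by apply: ge0_subset_integral => //; exact: shift_cube_measurable.
Qed.

Lemma measurable_average i : measurable_fun setT (average f i).
Proof.
apply: (@measurable_section_average _ _ _ _ _ (finite_lambda01 R) _ _ p1) => //.
- exact: measurable_comp_set_head.
- by rewrite integral_set_head_powR integral_shift_cube_lty.
Qed.

Lemma energy_average i :
  energy (average f) i <= \int[m]_(y in E i) (`|f y| `^ p)%:E.
Proof.
have := @section_average_le _ _ _ _ _ (finite_lambda01 R) _
  (unit_rect_measureT hm (@shift_side_measurable R i) (@shift_side_measure R i))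
  p p1 _ measurable_comp_set_head.
by rewrite (integral_set_head_powR i) => /(_ (integral_shift_cube_lty i)).
Qed.

(** Averaging contracts on each piece, and the pieces are disjoint. *)
Lemma esum_energy_average :
  \esum_(i in setT) energy (average f) i <= \int[m]_y (`|f y| `^ p)%:E.
Proof.
apply: (@le_trans _ _ (\esum_(i in setT) \int[m]_(y in E i) (`|f y| `^ p)%:E)).
  by apply: le_esum => i _; exact: energy_average.
apply: esum_integral_le => //.
- exact: shift_cube_measurable.
- exact: shift_cube_disjoint.
Qed.

Lemma ellp_average : ellp p (average f).
Proof.
apply/ellpP; split; first exact: measurable_average.
by apply: le_lt_trans esum_energy_average _; have /(Lfun_integralP _ _ p1)[] := Lf.
Qed.

Lemma Lnorm_embed_average :
  'N[m]_(p%:E)[EFin \o embed (average f)] <= 'N[m]_(p%:E)[EFin \o f].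
Proof.
rewrite Lnorm_embed; last exact: ellp_average.
rewrite ellp_normE LnormE_integral; apply: gt0_ler_poweR.
- by rewrite invr_ge0 ltW.
- by rewrite in_itv/= leey esum_ge0// => i _; exact: energy_ge0.
- by rewrite in_itv/= leey integral_ge0.
- exact: esum_energy_average.
Qed.

End average_Lp.

Lemma average_linear f1 f2 (a : R) i : f1 \in Lfun m p%:E -> f2 \in Lfun m p%:E ->
  (lambda01 R).-negligible [set x | average (fun y => a * f1 y + f2 y)%R i x !=
    (a * average f1 i x + average f2 i x)%R].
Proof.
move=> L1 L2.
have := @section_averageD _ _ _ _ _ (finite_lambda01 R)
  (unit_rect_measure hm (@shift_side_measurable R i) (@shift_side_measure R i))
  p p1 (fun z => f1 (set_head z)) (fun z => f2 (set_head z)) a.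
rewrite !integral_set_head_powR// => H.
have := H (measurable_comp_set_head L1) (integral_shift_cube_lty L1 i)
  (measurable_comp_set_head L2) (integral_shift_cube_lty L2 i).
by apply: negligibleS => x /= /eqP neq /(_ Logic.I) eqx; apply: neq.
Qed.

Lemma embed_average_linear f1 f2 (a : R) :
  f1 \in Lfun m p%:E -> f2 \in Lfun m p%:E ->
  embed (average (fun y => a * f1 y + f2 y)%R) =
  (fun y => a * embed (average f1) y + embed (average f2) y)%R %[ae m].
Proof.
move=> L1 L2.
have L12 : (fun y => a * f1 y + f2 y)%R \in Lfun m p%:E.
  rewrite (_ : (fun y => _) = (a \o* f1 + f2)%R); last first.
    by apply/funext => y /=; rewrite mulrC.
  have p1E : 1 <= p%:E by rewrite lee_fin.
  by have [_] := Lfun_addr_closed m p1E; apply=> //; exact: Lfun_scale.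
pose S := active (average f1) `|` active (average f2).
apply: (embed_ae_eq (S := S)).
- exact/active_countable/ellp_average.
- by apply: countable_setU; exact/active_countable/ellp_average.
- exact: measurable_average.
- move=> y nS; rewrite !embed_outside ?mulr0 ?addr0// => -[i gi Ey]; apply: nS.
    by exists i => //; right.
  by exists i => //; left.
- move=> i.
  (* Three null sets: two where an embedded average differs from the average itself, one where
     averaging fails to be linear. *)
  apply: negligibleS (negligibleU (negligibleU
    (embed_negligible (measurable_average L1 i))
    (embed_negligible (measurable_average L2 i)))
    (shift_cube_head_negligible i (average_linear a i L1 L2))).
  move=> y [Ey] /= neq.
  have [y1|y1] := eqVneq (embed (average f1) y) (average f1 i (y 0%N)); last first.
    by left; left.
  have [y2|y2] := eqVneq (embed (average f2) y) (average f2 i (y 0%N)); last first.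
    by left; right.
  by right; split=> //=; rewrite -y1 -y2 eq_sym.
Qed.

(** With the first coordinate fixed, the embedded function is constant over the tails in [E i];
    these carry all the mass, so averaging returns the constant. *)
Lemma average_embed g i y : ellp p g -> E i y ->
  average (embed g) i (y 0%N) = embed g y.
Proof.
move=> eg Ey; have [mg _] := (ellpP g).1 eg.
have mJ := measurable_embed (active_countable eg) mg.
rewrite /average /section_average.
set mu := unit_rect_measure _ _ _.
have Ez z : E i z -> E i (set_head (y 0%N, z)).
  by move=> Ez [|n]; [exact: (Ey 0%N)|exact: (Ez n.+1)].
have -> : \int[mu]_z (embed g (set_head (y 0%N, z)))%:E =
    \int[mu]_z (cst (embed g y)%:E z).
  apply: ae_eq_integral => //.
    apply/measurable_EFinP; apply: (measurableT_comp mJ).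
    exact: (measurableT_comp (@measurable_set_head R) (measurable_pair1 _)).
  exists (~` E i); split.
  - by apply: measurableC; exact: shift_cube_measurable.
  - by rewrite /= /mfrestr /mrestr setICl measure0.
  - move=> z /= neq Eiz; apply: neq => _; congr (_%:E).
    have [gi|gi] := pselect (active g i).
      by rewrite (embed_active gi (Ez _ Eiz)) (embed_active gi Ey).
    by rewrite (embed_inactive gi (Ez _ Eiz)) (embed_inactive gi Ey).
rewrite integral_cst//= /mfrestr /mrestr setTI.
by rewrite (measure_unit_rect hm (@shift_side_measurable R i)
  (@shift_side_measure R i)) mule1.
Qed.

Lemma embed_average_embed g : ellp p g ->
  embed (average (embed g)) = embed g %[ae m].
Proof.
move=> eg; have LJ := embed_Lfun eg.
apply: (embed_ae_eq (S := active g)).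
- exact/active_countable/ellp_average.
- exact: active_countable.
- exact: measurable_average.
- by move=> y /embed_outside.
- move=> i; apply: negligibleS (negligible_set0 m) => y [Ey] /=.
  by rewrite average_embed// eqxx.
Qed.

End embedding.

Theorem theorem3p6 (R : realType) (m : {measure set (RN R) -> \bar R})
    (hm : forall A : set (RN R), measurable A -> m A = mu_star A)
    (p : R) (hp : 1 <= p) :
  exists (J : (R -> measurableTypeR R -> R) -> (RN R -> R))
         (P : (RN R -> R) -> (RN R -> R)),
  ((* J maps l^p(c, L^p[0,1]) into B^p, linearly and isometrically *)
      (forall g, ellp p g -> Bp m p (J g)) /\
      (forall g h (a : R), ellp p g -> ellp p h ->
        J (fun i x => a * g i x + h i x) = (fun y => a * J g y + J h y) %[ae m]) /\
      (forall g, ellp p g -> Lnorm m p%:E (EFin \o J g) = ellp_norm p g)) /\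
      (* P is a bounded linear projection of B^p onto the image of J *)
      ((forall f, Bp m p f -> Bp m p (P f)) /\
      (forall f1 f2 (a : R), Bp m p f1 -> Bp m p f2 ->
        P (fun y => a * f1 y + f2 y) = (fun y => a * P f1 y + P f2 y) %[ae m]) /\
      (exists C : R, forall f, Bp m p f ->
        (Lnorm m p%:E (EFin \o P f) <= C%:E * Lnorm m p%:E (EFin \o f))%E) /\
      (forall g, ellp p g -> P (J g) = J g %[ae m]) /\
      (forall f, Bp m p f -> exists g, ellp p g /\ P f = J g %[ae m])).
Proof.
(* The projection is averaging followed by the embedding, so each [P f] is by construction an image
   under [J], and the norm bound holds with constant 1. *)
exists (embed p), (fun f => embed p (average hm f)); split; last split.
- split; first by move=> g; exact: embed_Bp.
  by split=> [g h a|g]; [exact: embed_linear|exact: Lnorm_embed].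
- by move=> f [Lf _]; apply: embed_Bp => //; exact: ellp_average.
split; first by move=> f1 f2 a [L1 _] [L2 _]; exact: embed_average_linear.
split; first by exists 1 => f [Lf _]; rewrite mul1e; exact: Lnorm_embed_average.
split; first by move=> g; exact: embed_average_embed.
move=> f [Lf _]; exists (average hm f); split; first exact: ellp_average.
exact: ae_eq_refl.
Qed.
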